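(* Let $t_0,b\in\mathbb{R}$ with $t_0<b$, and $\tau>0$. Let $f\in C([t_0,b]\times\mathbb{R}^2,\mathbb{R})$ and $\psi\in C([t_0-\tau,b],\mathbb{R})$. Assume there exists $L_f>0$ such that $$|f(t,u_1,u_2)-f(t,v_1,v_2)|\le L_f\sum_{i=1}^2|u_i-v_i|\qquad\text{for all }u_1,u_2,v_1,v_2\in\mathbb{R},\ t\in[t_0,b],$$ and that $2L_f(b-t_0)<1$. Then the delay differential problem $$x'(t)=f(t,x(t),x(t-\tau)),\quad t\in[t_0,b],\qquad x(t)=\psi(t),\quad t\in[t_0-\tau,t_0],$$ has a unique solution $x_*$ in $C([t_0-\tau,b],\mathbb{R})\cap C^1([t_0,b],\mathbb{R})$. Moreover, the Picard-S iteration method converges to $x_*$: for real sequences $\{\eta_n^1\}_{n=0}^\infty$, $\{\eta_n^2\}_{n=0}^\infty$ in $[0,1]$ and any $x_0\in C([t_0-\tau,b],\mathbb{R})$, the sequence defined by $$x_{n+1}=Ty_n,\qquad y_n=(1-\eta_n^1)Tx_n+\eta_n^1Tz_n,\qquad z_n=(1-\eta_n^2)x_n+\eta_n^2Tx_n,\qquad n\in\mathbb{N},$$ where $T:C([t_0-\tau,b],\mathbb{R})\to C([t_0-\tau,b],\mathbb{R})$ is the operator $$Tx(t)=\begin{cases}\psi(t), & t\in[t_0-\tau,t_0],\\[2pt] \psi(t_0)+\displaystyle\int_{t_0}^tf(s,x(s),x(s-\tau))\,ds, & t\in[t_0,b],\end{cases}$$ satisfies $\lim_{n\to\infty}\|x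_n-x_*\|_\infty=0$.
   Context: $\mathbb{N}$ denotes the set of nonnegative integers $\{0,1,2,\dots\}$. The superscripts in $\eta_n^1,\eta_n^2$ are indices, not powers. $C([t_0-\tau,b],\mathbb{R})$ is the Banach space of continuous real-valued functions on $[t_0-\tau,b]$ with the Chebyshev norm $\|x\|_\infty=\max_{t\in[t_0-\tau,b]}|x(t)|$. The notation $x\in C([t_0-\tau,b],\mathbb{R})\cap C^1([t_0,b],\mathbb{R})$ means that $x$ is continuous on $[t_0-\tau,b]$ and its restriction to $[t_0,b]$ is continuously differentiable (one-sided derivatives at the endpoints). A solution of the problem is a function in this class satisfying the differential equation on $[t_0,b]$ and the initial condition on $[t_0-\tau,t_0]$. *)

(* Defs.v *)
From Stdlib Require Import Reals Lra.
From Coquelicot Require Import Coquelicot.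
Open Scope R_scope.

Definition Icc (a b t : R) : Prop := a <= t <= b.

(* C([a,b],R).  An element of this space is a total function R -> R, considered
   only through its values on [a,b]: continuity is relative to [a,b], and two
   functions agreeing on [a,b] are the same element. *)
Definition C0_on (a b : R) (x : R -> R) : Prop := continuous_on (Icc a b) x.

(* Coquelicot's [is_derive x t l] with [locally t] restricted to [a,b]: two-sided
   inside, one-sided at the endpoints. *)
Definition is_derive_on (a b : R) (x : R -> R) (t l : R) : Prop :=
  filterdiff x (within (Icc a b) (locally t)) (fun h : R => scal h l).

Definition C1_on (a b : R) (x : R -> R) : Prop :=
  exists dx : R -> R,
    C0_on a b dx /\ forall t, a <= t <= b -> is_derive_on a b x t (dx t).

(* [Lub_Rbar] lives in the extended reals and [real] sends infinities to 0; by
   [cheb_norm_max] this is the maximum of |x| on [a,b] whenever x is in C([a,b]). *)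
Definition cheb_norm (a b : R) (x : R -> R) : R :=
  real (Lub_Rbar (fun y => exists t, a <= t <= b /\ y = Rabs (x t))).

Definition is_solution (t0 b tau : R) (f : R -> R -> R -> R) (psi x : R -> R)
  : Prop :=
  C0_on (t0 - tau) b x /\
  C1_on t0 b x /\
  (forall t, t0 <= t <= b -> is_derive_on t0 b x t (f t (x t) (x (t - tau)))) /\
  (forall t, t0 - tau <= t <= t0 -> x t = psi t).

(* At t = t0 the two branches coincide. *)
Definition T_op (t0 tau : R) (f : R -> R -> R -> R) (psi x : R -> R) : R -> R :=
  fun t =>
    if Rle_dec t t0 then psi t
    else psi t0 + RInt (fun s => f s (x s) (x (s - tau))) t0 t.

Fixpoint picardS (T : (R -> R) -> (R -> R)) (eta1 eta2 : nat -> R)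
  (x0 : R -> R) (n : nat) : R -> R :=
  match n with
  | O => x0
  | S k =>
      let x := picardS T eta1 eta2 x0 k in
      let z := fun t => (1 - eta2 k) * x t + eta2 k * T x t in
      let y := fun t => (1 - eta1 k) * T x t + eta1 k * T z t in
      T y
  end.

Lemma cheb_norm_max (a b : R) (x : R -> R) (hab : a <= b) (hx : C0_on a b x) :
  (exists t, a <= t <= b /\ cheb_norm a b x = Rabs (x t)) /\
  (forall t, a <= t <= b -> Rabs (x t) <= cheb_norm a b x).
Proof.
set (c := fun t => Rmax a (Rmin b t)).
assert (cI : forall t, a <= c t <= b).
{ intros t; unfold c, Rmax, Rmin.
  destruct (Rle_dec b t); destruct (Rle_dec a _); lra. }
assert (cE : forall t, a <= t <= b -> c t = t).
{ intros t Ht; unfold c, Rmax, Rmin.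
  destruct (Rle_dec b t); destruct (Rle_dec a _); lra. }
assert (cL : forall s t, Rabs (c s - c t) <= Rabs (s - t)).
{ intros s t; unfold c, Rmax, Rmin.
  destruct (Rle_dec b s); destruct (Rle_dec b t);
  repeat destruct (Rle_dec a _);
  unfold Rabs; repeat destruct (Rcase_abs _); lra. }
destruct (continuity_ab_maj (fun t => Rabs (x (c t))) a b hab) as [M [HM IM]].
{ intros t _.
  apply continuity_pt_filterlim.
  apply (filterlim_comp _ _ _ (fun t => x (c t)) Rabs _ (locally (x (c t)))).
  - apply (filterlim_comp _ _ _ c x _ (within (Icc a b) (locally (c t)))).
    + intros P [d Hd]; exists d; intros s Hs.
      apply Hd; [|apply cI].
      apply Rle_lt_trans with (2 := Hs); apply cL.
    + apply hx, cI.
  - apply (continuous_Rabs (x (c t))). }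
assert (E : cheb_norm a b x = Rabs (x M)).
{ unfold cheb_norm.
  rewrite (is_lub_Rbar_unique _ (Finite (Rabs (x M)))); [reflexivity|].
  split.
  - intros y [t [Ht ->]]; simpl.
    rewrite <- (cE t Ht), <- (cE M IM); exact (HM t Ht).
  - intros l Hl; apply Hl; exists M; auto. }
split.
- exists M; auto.
- intros t Ht; rewrite E, <- (cE t Ht), <- (cE M IM); exact (HM t Ht).
Qed.

(* Main.v *)
(** Uniqueness and existence come from the Banach fixed point argument: [T] is
    a [q]-contraction for the Chebyshev norm with [q = 2 Lf (b - t0) < 1], and
    solutions of the delay problem are exactly its fixed points.  One Picard-S
    step maps [x] to [T y], where [y] is at distance at most [q |x - xs|] from
    the fixed point [xs], because averaging with coefficients in [0,1] does not
    increase the distance to [xs]; hence [|x_n - xs| <= q^n |x_0 - xs|]. *)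

Require Import Defs.
From Stdlib Require Import Reals Lra Lia.
From Coquelicot Require Import Coquelicot.
Open Scope R_scope.

(** * Continuity relative to a closed interval *)

(* Precomposing with [clamp a b] turns continuity relative to [a,b] into
   continuity on the whole line. *)
Definition clamp (a b t : R) : R := Rmax a (Rmin b t).

Lemma clamp_in (a b t : R) : a <= b -> a <= clamp a b t <= b.
Proof.
intros hab; unfold clamp, Rmax, Rmin.
destruct (Rle_dec b t); destruct (Rle_dec a _); lra.
Qed.

Lemma clamp_id (a b t : R) : a <= t <= b -> clamp a b t = t.
Proof.
intros Ht; unfold clamp, Rmax, Rmin.
destruct (Rle_dec b t); destruct (Rle_dec a _); lra.
Qed.

Lemma clamp_lip (a b s t : R) :
  Rabs (clamp a b s - clamp a b t) <= Rabs (s - t).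
Proof.
unfold clamp, Rmax, Rmin.
destruct (Rle_dec b s); destruct (Rle_dec b t);
repeat destruct (Rle_dec a _);
unfold Rabs; repeat destruct (Rcase_abs _); lra.
Qed.

(** Being 1-Lipschitz with values in [a,b], [clamp a b] converges along the restricted filter, which
    is the one relative continuity is stated with. *)
Lemma clamp_within (a b t : R) : a <= b ->
  filterlim (clamp a b) (locally t) (within (Icc a b) (locally (clamp a b t))).
Proof.
intros hab P [d Hd]; exists d; intros s Hs.
apply Hd; [|now apply clamp_in].
exact (Rle_lt_trans _ _ _ (clamp_lip a b s t) Hs).
Qed.

Lemma continuous_clamp (a b t : R) : a <= b -> continuous (clamp a b) t.
Proof.
intros hab P HP; apply (clamp_within a b t hab).
now apply filter_le_within.
Qed.

Lemma continuous_C0_clamp (a b : R) (x : R -> R) (t : R) :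
  a <= b -> C0_on a b x -> continuous (fun s => x (clamp a b s)) t.
Proof.
intros hab hx.
apply (filterlim_comp _ _ _ (clamp a b) x _
  (within (Icc a b) (locally (clamp a b t)))).
- now apply clamp_within.
- now apply hx, clamp_in.
Qed.

(** The way back from the whole line: a two-sided continuous [y], typically built with [clamp],
    witnesses the relative continuity of [x]. *)
Lemma C0_on_continuous_ext (a b : R) (y x : R -> R) :
  (forall t, a <= t <= b -> continuous y t) ->
  (forall t, a <= t <= b -> x t = y t) -> C0_on a b x.
Proof.
intros hy hxy t Ht P HP; rewrite (hxy t Ht) in HP.
generalize (hy t Ht P HP); unfold filtermap, within; apply filter_imp.
intros s Hs Is; now rewrite (hxy s Is).
Qed.

Lemma C0_on_lin (a b k l : R) (x y : R -> R) :
  a <= b -> C0_on a b x -> C0_on a b y ->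
  C0_on a b (fun t => k * x t + l * y t).
Proof.
intros hab hx hy.
apply (C0_on_continuous_ext a b
  (fun t => plus (scal k (x (clamp a b t))) (scal l (y (clamp a b t))))).
- intros t _; apply (continuous_plus (V := R_NormedModule));
    apply (continuous_scal_r (V := R_NormedModule)); now apply continuous_C0_clamp.
- intros t Ht; now rewrite clamp_id.
Qed.

Lemma C0_on_uniform_lim (a b : R) (X : nat -> R -> R) (x : R -> R) :
  (forall n, C0_on a b (X n)) ->
  (forall eps : posreal, exists n, forall t, a <= t <= b ->
     Rabs (X n t - x t) < eps) ->
  C0_on a b x.
Proof.
intros hX hu t Ht; apply filterlim_locally; intros eps.
(* [e3] is a quarter of [eps]; the usual three errors of a uniform limit then add up to less than
   [eps]. *)
set (e3 := pos_div_2 (pos_div_2 eps)).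
destruct (hu e3) as [n Hn].
pose proof (proj1 (filterlim_locally _ _) (hX n t Ht) e3) as Hc.
revert Hc; unfold within; apply filter_imp; intros s Hs Is.
specialize (Hs Is); change (Rabs (X n s - X n t) < e3) in Hs.
change (Rabs (x s - x t) < eps).
pose proof (Hn s Is) as H1; pose proof (Hn t Ht) as H2.
unfold e3 in *; simpl in *.
apply Rabs_def2 in Hs; apply Rabs_def2 in H1; apply Rabs_def2 in H2.
destruct eps as [e he]; simpl in *.
apply Rabs_def1; lra.
Qed.

(** * Derivatives relative to a closed interval *)

(** [filterdiff] quantifies over all limit points of the filter. Since [t] itself lies in [a,b],
    every such point is arbitrarily close to [t], hence equal to it. *)
Lemma is_derive_onP (a b : R) (x : R -> R) (t l : R) : a <= t <= b ->
  is_derive_on a b x t l <->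
  forall eps : posreal, within (Icc a b) (locally t)
    (fun s => Rabs (x s - x t - (s - t) * l) <= eps * Rabs (s - t)).
Proof.
intros Ht; split.
- intros [_ hd]; apply hd; intros P HP; now apply filter_le_within.
- intros hd; split; [apply (is_linear_scal_l (K := R_AbsRing) (V := R_NormedModule))|].
  intros u Hu.
  assert (E : u = t).
  { apply eq_close; intros eps.
    destruct (Hu _ (locally_ball u eps)) as [d Hd].
    exact (Hd t (ball_center t d) Ht). }
  rewrite E; exact hd.
Qed.

Lemma is_derive_on_ext (a b : R) (x y : R -> R) (t l : R) :
  (forall s, a <= s <= b -> x s = y s) -> a <= t <= b ->
  is_derive_on a b x t l -> is_derive_on a b y t l.
Proof.
intros hxy Ht hd.
apply is_derive_onP; [exact Ht|]; intros eps.
generalize (proj1 (is_derive_onP a b x t l Ht) hd eps).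
unfold within; apply filter_imp; intros s Hs Is.
rewrite <- (hxy s Is), <- (hxy t Ht); now apply Hs.
Qed.

Lemma is_derive_is_derive_on (a b : R) (x : R -> R) (t l : R) :
  a <= t <= b -> is_derive x t l -> is_derive_on a b x t l.
Proof.
intros Ht [_ hd].
apply is_derive_onP; [exact Ht|]; intros eps.
apply filter_le_within.
apply hd; intros P HP; exact HP.
Qed.

(** Near an interior point [clamp a b] is the identity and the restriction to [a,b] is vacuous. At
    an endpoint clamping may create a kink. *)
Lemma is_derive_on_clamp (a b : R) (x : R -> R) (t l : R) :
  a < t < b -> is_derive_on a b x t l ->
  is_derive (fun s => x (clamp a b s)) t l.
Proof.
intros Ht hd; split; [apply (is_linear_scal_l (K := R_AbsRing) (V := R_NormedModule))|].
intros u Hu; rewrite <- (is_filter_lim_locally_unique _ _ Hu); clear u Hu.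
intros eps.
assert (HI : locally t (fun s => a < s < b)).
{ apply (open_and _ _ (open_gt a) (open_lt b)); exact Ht. }
assert (Ht' : a <= t <= b) by lra.
generalize (filter_and _ _ HI (proj1 (is_derive_onP a b x t l Ht') hd eps)).
apply filter_imp; intros s [Is Hs].
rewrite !clamp_id by lra.
apply Hs; unfold Icc; lra.
Qed.

(** * Integrals and the fundamental theorem of calculus on an interval *)

Lemma ex_RInt_clamp (a b : R) (g : R -> R) (c d : R) :
  a <= b -> C0_on a b g -> ex_RInt (fun s => g (clamp a b s)) c d.
Proof.
intros hab hg; apply (ex_RInt_continuous (V := R_CompleteNormedModule)).
intros s _; now apply (continuous_C0_clamp a b g).
Qed.

Lemma ex_RInt_C0_on (a b : R) (g : R -> R) (t : R) :
  a <= t <= b -> C0_on a b g -> ex_RInt g a t.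
Proof.
intros Ht hg.
apply (ex_RInt_ext (fun s => g (clamp a b s))).
- rewrite Rmin_left, Rmax_right by lra; intros s Hs.
  now rewrite clamp_id by lra.
- apply ex_RInt_clamp; [lra|exact hg].
Qed.

Lemma RInt_clamp (a b : R) (g : R -> R) (t : R) : a <= t <= b ->
  RInt (fun s => g (clamp a b s)) a t = RInt g a t.
Proof.
intros Ht; apply RInt_ext.
rewrite Rmin_left, Rmax_right by lra; intros s Hs.
now rewrite clamp_id by lra.
Qed.

Lemma is_derive_RInt_clamp (a b : R) (g : R -> R) (t : R) :
  a <= b -> C0_on a b g ->
  is_derive (fun u => RInt (fun s => g (clamp a b s)) a u) t (g (clamp a b t)).
Proof.
intros hab hg.
apply (is_derive_RInt (fun s => g (clamp a b s)) _ a).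
- apply filter_forall; intros u.
  apply (RInt_correct (V := R_CompleteNormedModule)).
  now apply ex_RInt_clamp.
- now apply (continuous_C0_clamp a b g).
Qed.

Lemma is_derive_on_RInt (a b c : R) (g : R -> R) (t : R) :
  a <= t <= b -> C0_on a b g ->
  is_derive_on a b (fun u => c + RInt g a u) t (g t).
Proof.
intros Ht hg.
apply (is_derive_on_ext a b
  (fun u => c + RInt (fun s => g (clamp a b s)) a u)); [|exact Ht|].
- intros u Hu; now rewrite RInt_clamp.
- apply is_derive_is_derive_on; [exact Ht|].
  replace (g t) with (plus zero (g (clamp a b t)))
    by (rewrite plus_zero_l; now rewrite clamp_id).
  apply (is_derive_plus (fun _ => c)); [apply (is_derive_const (V := R_NormedModule))|].
  apply is_derive_RInt_clamp; [lra|exact hg].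
Qed.

(** The clamped [x] minus the integral of the clamped [g] is continuous with zero derivative inside
    the interval, so the mean value theorem makes it constant. *)
Lemma is_derive_on_eq_RInt (a b : R) (x g : R -> R) (t : R) :
  C0_on a b x -> C0_on a b g ->
  (forall s, a <= s <= b -> is_derive_on a b x s (g s)) ->
  a <= t <= b -> x t = x a + RInt g a t.
Proof.
intros hx hg hd Ht.
set (I := fun u => RInt (fun s => g (clamp a b s)) a u).
destruct (MVT_gen (fun u => minus (x (clamp a b u)) (I u)) a t (fun _ => 0))
  as [c [_ E]].
- rewrite Rmin_left, Rmax_right by lra; intros s Hs.
  assert (Is : a < s < b) by lra.
  replace 0 with (minus (g s) (g (clamp a b s)))
    by (rewrite clamp_id by lra; unfold minus, plus, opp; simpl; ring).
  apply (is_derive_minus (fun u => x (clamp a b u)) I).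
  + apply is_derive_on_clamp; [exact Is|apply hd; lra].
  + apply is_derive_RInt_clamp; [lra|exact hg].
- intros s _; apply continuity_pt_filterlim.
  apply (continuous_minus (fun u => x (clamp a b u)) I).
  + apply continuous_C0_clamp; [lra|exact hx].
  + apply (ex_derive_continuous I); eexists.
    apply is_derive_RInt_clamp; [lra|exact hg].
- unfold I in E.
  rewrite RInt_point, RInt_clamp, !clamp_id in E by lra.
  unfold minus, plus, opp, zero in E; simpl in E; lra.
Qed.

(** * Continuity and contraction for the integral operator *)

Lemma C0_on_delay_rhs (t0 b tau : R) (f : R -> R -> R -> R) (x : R -> R) :
  0 < tau ->
  continuous_on (fun p : R * (R * R) => t0 <= fst p <= b)
    (fun p : R * (R * R) => f (fst p) (fst (snd p)) (snd (snd p))) ->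
  C0_on (t0 - tau) b x ->
  C0_on t0 b (fun s => f s (x s) (x (s - tau))).
Proof.
intros htau hf hx s Is P HP; unfold Icc in Is.
destruct (hf (s, (x s, x (s - tau))) Is P HP) as [d Hd].
assert (I1 : Icc (t0 - tau) b s) by (unfold Icc; lra).
assert (I2 : Icc (t0 - tau) b (s - tau)) by (unfold Icc; lra).
destruct (hx s I1 _ (locally_ball _ d)) as [d1 H1].
destruct (hx (s - tau) I2 _ (locally_ball _ d)) as [d2 H2].
(* The three radii come from [f] at the triple, [x] at [s], and [x] at [s - tau]; the shift by [tau]
   preserves distances. *)
assert (hm : 0 < Rmin d (Rmin d1 d2))
  by (repeat apply Rmin_glb_lt; apply cond_pos).
exists (mkposreal _ hm); intros u Hu Iu; unfold Icc in Iu.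
change (Rabs (u - s) < Rmin d (Rmin d1 d2)) in Hu.
pose proof (Rmin_l d (Rmin d1 d2)); pose proof (Rmin_r d (Rmin d1 d2)).
pose proof (Rmin_l d1 d2); pose proof (Rmin_r d1 d2).
apply (Hd (u, (x u, x (u - tau)))); [|exact Iu].
split; [|split]; simpl.
- change (Rabs (u - s) < d); lra.
- apply H1; [change (Rabs (u - s) < d1); lra|unfold Icc; lra].
- apply H2; [|unfold Icc; lra].
  change (Rabs (u - tau - (s - tau)) < d2).
  replace (u - tau - (s - tau)) with (u - s) by ring; lra.
Qed.

Lemma T_op_left (t0 tau : R) f psi x t :
  t <= t0 -> T_op t0 tau f psi x t = psi t.
Proof.
intros Ht; unfold T_op; destruct (Rle_dec t t0); [reflexivity|lra].
Qed.

Lemma T_op_right (t0 tau : R) f psi x t : t0 <= t ->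
  T_op t0 tau f psi x t = psi t0 + RInt (fun s => f s (x s) (x (s - tau))) t0 t.
Proof.
intros Ht; unfold T_op; destruct (Rle_dec t t0) as [h|h]; [|reflexivity].
replace t with t0 by lra; rewrite RInt_point; symmetry; apply Rplus_0_r.
Qed.

Lemma C0_on_sub (a b c d : R) (x : R -> R) :
  c <= a -> b <= d -> C0_on c d x -> C0_on a b x.
Proof.
intros hca hbd hx.
apply (continuous_on_subset (Icc c d) (Icc a b)); [|exact hx].
unfold Icc; intros s Hs; lra.
Qed.

(** The two branches are glued as one sum: [psi] frozen at [psi t0] after [t0], plus an integral
    that vanishes before [t0]. Each summand is continuous everywhere, so the junction needs no
    separate study. *)
Lemma C0_on_T_op (t0 b tau : R) f psi x :
  t0 < b -> 0 < tau -> C0_on (t0 - tau) b psi ->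
  C0_on t0 b (fun s => f s (x s) (x (s - tau))) ->
  C0_on (t0 - tau) b (T_op t0 tau f psi x).
Proof.
intros htb htau hpsi hF.
set (F := fun s => f s (x s) (x (s - tau))) in *.
apply (C0_on_continuous_ext (t0 - tau) b
  (fun t => plus (psi (clamp (t0 - tau) t0 t))
    (RInt (fun s => F (clamp t0 b s)) t0 (clamp t0 b t)))).
- intros t _; apply (continuous_plus (V := R_NormedModule)).
  + apply continuous_C0_clamp; [lra|].
    apply (C0_on_sub _ _ (t0 - tau) b); [lra|lra|exact hpsi].
  + apply (continuous_comp (clamp t0 b)
      (fun u => RInt (fun s => F (clamp t0 b s)) t0 u)).
    * apply continuous_clamp; lra.
    * apply (ex_derive_continuous
        (fun u => RInt (fun s => F (clamp t0 b s)) t0 u)); eexists.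
      apply is_derive_RInt_clamp; [lra|exact hF].
- intros t Ht; rewrite RInt_clamp by (apply clamp_in; lra).
  destruct (Rle_dec t t0) as [h|h].
  + rewrite T_op_left, (clamp_id _ _ t) by lra.
    replace (clamp t0 b t) with t0.
    * rewrite RInt_point; symmetry; apply Rplus_0_r.
    * unfold clamp; rewrite Rmin_right, Rmax_left; lra.
  + rewrite T_op_right, (clamp_id t0 b t) by lra.
    replace (clamp (t0 - tau) t0 t) with t0; [reflexivity|].
    unfold clamp; rewrite Rmin_left, Rmax_right; lra.
Qed.

(** The images agree up to [t0]. Beyond it the integrands differ by at most [2 * Lf * M], the
    current and the delayed argument contributing [M] each, over a length at most [b - t0]. *)
Lemma T_op_contraction (t0 b tau : R) f psi Lf M (x y : R -> R) :
  t0 < b -> 0 < tau -> 0 < Lf -> 0 <= M ->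
  (forall t u1 u2 v1 v2 : R, t0 <= t <= b ->
     Rabs (f t u1 u2 - f t v1 v2) <= Lf * (Rabs (u1 - v1) + Rabs (u2 - v2))) ->
  C0_on t0 b (fun s => f s (x s) (x (s - tau))) ->
  C0_on t0 b (fun s => f s (y s) (y (s - tau))) ->
  (forall t, t0 - tau <= t <= b -> Rabs (x t - y t) <= M) ->
  forall t, t0 - tau <= t <= b ->
    Rabs (T_op t0 tau f psi x t - T_op t0 tau f psi y t)
    <= 2 * Lf * (b - t0) * M.
Proof.
intros htb htau hLf hM hlip hFx hFy hxy t Ht.
assert (hLM : 0 <= 2 * Lf * M) by nra.
destruct (Rle_dec t t0) as [h|h].
- rewrite !T_op_left by exact h.
  rewrite Rminus_diag, Rabs_R0; nra.
- rewrite !T_op_right by lra.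
  assert (It : t0 <= t <= b) by lra.
  assert (ex := ex_RInt_C0_on _ _ _ _ It hFx).
  assert (ey := ex_RInt_C0_on _ _ _ _ It hFy).
  match goal with |- Rabs (?p + ?u - (?p + ?v)) <= _ =>
    replace (p + u - (p + v)) with (minus u v)
      by (unfold minus, plus, opp; simpl; ring) end.
  rewrite <- (RInt_minus (V := R_CompleteNormedModule)) by assumption.
  apply Rle_trans with ((t - t0) * (2 * Lf * M)); [|nra].
  apply abs_RInt_le_const; [lra| |].
  + now apply (ex_RInt_minus (V := R_NormedModule)).
  + intros s Hs.
    apply Rle_trans with (1 := hlip s _ _ _ _ ltac:(lra)).
    assert (H1 := hxy s ltac:(lra)).
    assert (H2 := hxy (s - tau) ltac:(lra)).
    nra.
Qed.

(** * Geometric decay and convexity of balls *)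

Lemma is_lim_seq_pow_mult (q K : R) :
  0 <= q < 1 -> is_lim_seq (fun n => q ^ n * K) 0.
Proof.
intros hq; rewrite <- (Rmult_0_l K).
apply (is_lim_seq_mult' _ (fun _ => K) 0 K); [|apply is_lim_seq_const].
apply is_lim_seq_geom; rewrite Rabs_pos_eq; lra.
Qed.

Lemma pow_mult_small (q K eps : R) :
  0 <= q < 1 -> 0 < eps -> exists n, q ^ n * K < eps.
Proof.
intros hq heps.
pose proof (is_lim_seq_pow_mult q K hq) as L.
apply is_lim_seq_spec in L.
destruct (L (mkposreal eps heps)) as [n Hn]; exists n.
specialize (Hn n (le_n n)); simpl in Hn; apply Rabs_def2 in Hn; lra.
Qed.

Lemma eq_of_pow_bound (q K u v : R) :
  0 <= q < 1 -> (forall n, Rabs (u - v) <= q ^ n * K) -> u = v.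
Proof.
intros hq H; destruct (Req_dec u v) as [E|N]; [exact E|exfalso].
assert (h : 0 < Rabs (u - v)) by (apply Rabs_pos_lt; lra).
destruct (pow_mult_small q K _ hq h) as [n Hn].
specialize (H n); lra.
Qed.

(** Closed balls are convex; this is where the range [0,1] of the Picard-S coefficients enters. *)
Lemma convex_dist (e u v w M : R) :
  0 <= e <= 1 -> Rabs (u - w) <= M -> Rabs (v - w) <= M ->
  Rabs ((1 - e) * u + e * v - w) <= M.
Proof.
intros he hu hv.
apply Rabs_le_between in hu; apply Rabs_le_between in hv.
apply Rabs_le_between; nra.
Qed.

(** * Fixed points of contractions for the Chebyshev norm *)

Definition C0_stable (a b : R) (T : (R -> R) -> R -> R) : Prop :=
  forall x, C0_on a b x -> C0_on a b (T x).

(** Phrased with an arbitrary uniform bound [M] instead of the norm, so that estimates can be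
    iterated without computing suprema. *)
Definition C0_contraction (a b q : R) (T : (R -> R) -> R -> R) : Prop :=
  forall x y M, C0_on a b x -> C0_on a b y -> 0 <= M ->
    (forall t, a <= t <= b -> Rabs (x t - y t) <= M) ->
    forall t, a <= t <= b -> Rabs (T x t - T y t) <= q * M.

Lemma cheb_dist_max (a b : R) (x y : R -> R) :
  a <= b -> C0_on a b x -> C0_on a b y ->
  let d := cheb_norm a b (fun t => x t - y t) in
  0 <= d /\ (exists t, a <= t <= b /\ d = Rabs (x t - y t)) /\
  forall t, a <= t <= b -> Rabs (x t - y t) <= d.
Proof.
intros hab hx hy d.
assert (hd : C0_on a b (fun t => x t - y t)).
{ apply (C0_on_continuous_ext a b
    (fun t => minus (x (clamp a b t)) (y (clamp a b t)))).
  - intros t _; apply (continuous_minus (V := R_NormedModule));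
      now apply continuous_C0_clamp.
  - intros t Ht; now rewrite clamp_id. }
destruct (cheb_norm_max a b _ hab hd) as [[t [Ht E]] H].
split; [|split; [now exists t|exact H]].
unfold d; rewrite E; apply Rabs_pos.
Qed.

(** Applying the contraction [n] times to two fixed points bounds their distance by [q ^ n * d] for
    every [n]. *)
Lemma C0_fixpoint_unique (a b q : R) T x y :
  a <= b -> 0 <= q < 1 -> C0_contraction a b q T ->
  C0_on a b x -> C0_on a b y ->
  (forall t, a <= t <= b -> T x t = x t) ->
  (forall t, a <= t <= b -> T y t = y t) ->
  forall t, a <= t <= b -> x t = y t.
Proof.
intros hab hq hT hx hy ex ey t Ht.
destruct (cheb_dist_max a b x y hab hx hy) as [hd [_ H]].
revert hd H; generalize (cheb_norm a b (fun s => x s - y s)); intros d hd H.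
apply (eq_of_pow_bound q d _ _ hq).
intros n; revert t Ht; induction n as [|n IH]; intros t Ht; simpl.
- rewrite Rmult_1_l; now apply H.
- rewrite <- (ex t Ht), <- (ey t Ht), Rmult_assoc.
  apply hT; auto.
  apply Rmult_le_pos; [apply pow_le; lra|exact hd].
Qed.

Lemma C0_fixpoint_exists (a b q : R) T x0 :
  a <= b -> 0 <= q < 1 -> C0_stable a b T -> C0_contraction a b q T ->
  C0_on a b x0 ->
  exists xs, C0_on a b xs /\ forall t, a <= t <= b -> T xs t = xs t.
Proof.
intros hab hq hS hT hx0.
set (X := fix X n := match n with O => x0 | S n => T (X n) end).
assert (hX : forall n, C0_on a b (X n)) by (induction n; simpl; auto).
destruct (cheb_dist_max a b (T x0) x0 hab (hX 1%nat) hx0) as [hd [_ H]].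
revert hd H; generalize (cheb_norm a b (fun s => T x0 s - x0 s)); intros d hd H.
(* [K] sums the geometric series of ratio [q] and first term [d]. As [q * K + d = K], the ball of
   radius [K] around [x0] traps all iterates. *)
set (K := d / (1 - q)).
assert (hK : 0 <= K) by (apply Rdiv_le_0_compat; lra).
assert (EK : q * K + d = K) by (unfold K; field; lra).
assert (hqK : forall n, 0 <= q ^ n * K)
  by (intros n; apply Rmult_le_pos; [apply pow_le; lra|exact hK]).
assert (H0 : forall k t, a <= t <= b -> Rabs (X k t - x0 t) <= K).
{ induction k as [|k IH]; intros t Ht; simpl.
  - rewrite Rminus_diag, Rabs_R0; exact hK.
  - replace (T (X k) t - x0 t)
      with ((T (X k) t - T x0 t) + (T x0 t - x0 t)) by ring.
    apply Rle_trans with (1 := Rabs_triang _ _).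
    pose proof (hT _ _ K (hX k) hx0 hK IH t Ht); pose proof (H t Ht); lra. }
(* Both sides of [H0] pushed through [n] applications of [T]: a uniform Cauchy estimate. *)
assert (HC : forall n k t, a <= t <= b ->
  Rabs (X (n + k)%nat t - X n t) <= q ^ n * K).
{ induction n as [|n IH]; intros k t Ht; simpl.
  - rewrite Rmult_1_l; now apply H0.
  - rewrite Rmult_assoc; apply hT; auto. }
(* A total function, meaningful only on [a,b], where the limit is shown to exist and be finite. *)
set (xs := fun t => real (Lim_seq (fun n => X n t))).
assert (HL : forall t, a <= t <= b -> is_lim_seq (fun n => X n t) (xs t)).
{ intros t Ht; apply Lim_seq_correct', ex_lim_seq_cauchy_corr.
  intros eps.
  destruct (pow_mult_small q K _ hq (cond_pos (pos_div_2 eps))) as [N HN].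
  exists N; intros n m Hn Hm; simpl in HN.
  pose proof (HC N (n - N)%nat t Ht) as H1.
  pose proof (HC N (m - N)%nat t Ht) as H2.
  replace (N + (n - N))%nat with n in H1 by lia.
  replace (N + (m - N))%nat with m in H2 by lia.
  apply Rabs_le_between in H1; apply Rabs_le_between in H2.
  apply Rabs_def1; lra. }
(* Letting [k] tend to infinity in [HC] gives convergence uniform in [t], hence a continuous
   limit. *)
assert (HU : forall n t, a <= t <= b -> Rabs (X n t - xs t) <= q ^ n * K).
{ intros n t Ht; rewrite Rabs_minus_sym.
  apply (is_lim_seq_le (fun k => Rabs (X (n + k)%nat t - X n t))
    (fun _ => q ^ n * K) (Rabs (xs t - X n t)) (q ^ n * K)).
  - intros k; now apply HC.
  - apply (is_lim_seq_abs _ (Finite (xs t - X n t))).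
    apply is_lim_seq_minus'; [|apply is_lim_seq_const].
    apply (is_lim_seq_ext (fun k => X (k + n)%nat t));
      [intros k; f_equal; lia|].
    apply (is_lim_seq_incr_n (fun k => X k t)); now apply HL.
  - apply is_lim_seq_const. }
assert (hxs : C0_on a b xs).
{ apply (C0_on_uniform_lim a b X); [exact hX|].
  intros eps; destruct (pow_mult_small q K _ hq (cond_pos eps)) as [n Hn].
  exists n; intros t Ht; exact (Rle_lt_trans _ _ _ (HU n t Ht) Hn). }
exists xs; split; [exact hxs|].
(* Both [T xs] and [xs] lie within [q * q ^ n * K] of [X (S n)], whence the factor 2. *)
intros t Ht; apply (eq_of_pow_bound q (2 * (q * K)) _ _ hq); intros n.
replace (T xs t - xs t)
  with (- (T (X n) t - T xs t) + (X (S n) t - xs t)) by (simpl; ring).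
apply Rle_trans with (1 := Rabs_triang _ _); rewrite Rabs_Ropp.
pose proof (hT _ _ _ (hX n) hxs (hqK n) (HU n) t Ht).
pose proof (HU (S n) t Ht) as H2; simpl in H2 |- *; lra.
Qed.

(** * Convergence of the Picard-S iteration and the delay problem *)

(** The induction carries continuity along with the bound, because the contraction estimate applies
    to continuous functions only. *)
Lemma picardS_dist (a b q : R) T eta1 eta2 x0 xs M :
  a <= b -> 0 <= q < 1 -> C0_stable a b T -> C0_contraction a b q T ->
  (forall n, 0 <= eta1 n <= 1) -> (forall n, 0 <= eta2 n <= 1) ->
  C0_on a b x0 -> C0_on a b xs ->
  (forall t, a <= t <= b -> T xs t = xs t) ->
  0 <= M -> (forall t, a <= t <= b -> Rabs (x0 t - xs t) <= M) ->
  forall n, C0_on a b (picardS T eta1 eta2 x0 n) /\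
    forall t, a <= t <= b ->
      Rabs (picardS T eta1 eta2 x0 n t - xs t) <= q ^ n * M.
Proof.
intros hab hq hS hT h1 h2 hx0 hxs es hM H.
induction n as [|n [hx IH]]; simpl.
- split; [exact hx0|intros t Ht; rewrite Rmult_1_l; now apply H].
- set (x := picardS T eta1 eta2 x0 n) in *.
  assert (hD : 0 <= q ^ n * M)
    by (apply Rmult_le_pos; [apply pow_le; lra|exact hM]).
  set (D := q ^ n * M) in *.
  assert (hqD : 0 <= q * D <= D) by nra.
  assert (step : forall u N, C0_on a b u -> 0 <= N ->
    (forall t, a <= t <= b -> Rabs (u t - xs t) <= N) ->
    forall t, a <= t <= b -> Rabs (T u t - xs t) <= q * N).
  { intros u N hu hN Hu t Ht; rewrite <- (es t Ht); now apply hT. }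
  set (z := fun t => (1 - eta2 n) * x t + eta2 n * T x t).
  assert (hz : C0_on a b z) by (apply C0_on_lin; auto).
  assert (Hz : forall t, a <= t <= b -> Rabs (z t - xs t) <= D).
  { intros t Ht; apply convex_dist; [apply h2|now apply IH|].
    apply Rle_trans with (q * D); [now apply step|lra]. }
  set (y := fun t => (1 - eta1 n) * T x t + eta1 n * T z t).
  assert (hy : C0_on a b y) by (apply C0_on_lin; auto).
  assert (Hy : forall t, a <= t <= b -> Rabs (y t - xs t) <= D).
  (* The bound [q * D] is relaxed to [D]; the outer application of [T] supplies the factor [q] of
     this step. *)
  { intros t Ht; apply Rle_trans with (q * D); [|lra].
    apply convex_dist; [apply h1|now apply step|now apply step]. }
  split; [now apply hS|].
  intros t Ht; rewrite Rmult_assoc; now apply step.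
Qed.

Theorem theorem6 (t0 b tau : R) (f : R -> R -> R -> R) (psi : R -> R) (Lf : R)
  (htb : t0 < b) (htau : 0 < tau)
  (hf : continuous_on (fun p : R * (R * R) => t0 <= fst p <= b)
          (fun p : R * (R * R) => f (fst p) (fst (snd p)) (snd (snd p))))
  (hpsi : C0_on (t0 - tau) b psi)
  (hLf : 0 < Lf)
  (hlip : forall t u1 u2 v1 v2 : R, t0 <= t <= b ->
     Rabs (f t u1 u2 - f t v1 v2) <= Lf * (Rabs (u1 - v1) + Rabs (u2 - v2)))
  (hcontr : 2 * Lf * (b - t0) < 1) :
  let T := T_op t0 tau f psi in
  (forall x : R -> R, C0_on (t0 - tau) b x -> C0_on (t0 - tau) b (T x)) /\
  exists xs : R -> R,
    is_solution t0 b tau f psi xs /\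
    (forall y : R -> R, is_solution t0 b tau f psi y ->
       forall t : R, t0 - tau <= t <= b -> y t = xs t) /\
    (forall (eta1 eta2 : nat -> R) (x0 : R -> R),
       (forall n : nat, 0 <= eta1 n <= 1) ->
       (forall n : nat, 0 <= eta2 n <= 1) ->
       C0_on (t0 - tau) b x0 ->
       is_lim_seq
         (fun n : nat => cheb_norm (t0 - tau) b
            (fun t : R => picardS T eta1 eta2 x0 n t - xs t))
         (Finite 0)).
Proof.
intros T.
assert (hF : forall x, C0_on (t0 - tau) b x ->
  C0_on t0 b (fun s => f s (x s) (x (s - tau))))
  by (intros x; now apply C0_on_delay_rhs).
assert (hS : C0_stable (t0 - tau) b T)
  by (intros x hx; apply C0_on_T_op; auto).
set (q := 2 * Lf * (b - t0)) in *.
assert (hq : 0 <= q < 1) by (unfold q in *; split; [nra|lra]).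
assert (hT : C0_contraction (t0 - tau) b q T).
{ intros x y M hx hy hM; now apply T_op_contraction; auto. }
assert (hab : t0 - tau <= b) by lra.
split; [exact hS|].
(* The iteration may start at [psi], which is continuous on the whole interval. *)
destruct (C0_fixpoint_exists _ _ q T psi hab hq hS hT hpsi) as [xs [hxs es]].
exists xs; split; [|split].
- assert (hd : forall t, t0 <= t <= b ->
    is_derive_on t0 b xs t (f t (xs t) (xs (t - tau)))).
  { intros t Ht.
    apply (is_derive_on_ext t0 b
      (fun u => psi t0 + RInt (fun s => f s (xs s) (xs (s - tau))) t0 u));
      [|exact Ht|].
    - intros s Is; rewrite <- (es s) by lra.
      symmetry; apply T_op_right; lra.
    - apply (is_derive_on_RInt t0 b (psi t0)
        (fun s => f s (xs s) (xs (s - tau)))); [exact Ht|now apply hF]. }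
  split; [exact hxs|split; [|split; [exact hd|]]].
  + exists (fun s => f s (xs s) (xs (s - tau))); split; [now apply hF|exact hd].
  + intros t Ht; rewrite <- (es t) by lra; apply T_op_left; lra.
- intros y [hy [_ [hd hi]]].
  apply (C0_fixpoint_unique _ _ q T y xs hab hq hT hy hxs); [|exact es].
  intros t Ht; destruct (Rle_dec t t0) as [h|h].
  + rewrite (hi t) by lra; now apply T_op_left.
  (* The initial condition at [t0] turns [psi t0] into [y t0]; integrating the equation then gives
     the fixed point identity. *)
  + unfold T; rewrite T_op_right by lra; rewrite <- (hi t0) by lra; symmetry.
    apply (is_derive_on_eq_RInt t0 b y (fun s => f s (y s) (y (s - tau))));
      [|now apply hF|exact hd|lra].
    apply (C0_on_sub _ _ (t0 - tau) b); [lra|lra|exact hy].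
- intros eta1 eta2 x0 h1 h2 hx0.
  destruct (cheb_dist_max _ _ x0 xs hab hx0 hxs) as [hM [_ HM]].
  set (M := cheb_norm _ _ _) in hM, HM.
  pose proof (picardS_dist _ _ q T eta1 eta2 x0 xs M hab hq hS hT h1 h2
    hx0 hxs es hM HM) as HP.
  apply (is_lim_seq_le_le (fun _ => 0) _ (fun n => q ^ n * M)).
  + intros n; destruct (HP n) as [hx Hn].
    set (x := picardS T eta1 eta2 x0 n) in *.
    (* The norm is attained at some [t], so the pointwise bound there bounds the norm. *)
    destruct (cheb_dist_max _ _ x xs hab hx hxs) as [hd [[t [Ht E]] _]].
    split; [exact hd|rewrite E; now apply Hn].
  + apply is_lim_seq_const.
  + now apply is_lim_seq_pow_mult.
Qed.
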